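(* Let $C$ be a finite skew brace with $(C,+)=A$ and $(C,\circ)=R$, let $T$ be a non-trivial finite abelian group with underlying set $\Omega$, let $\chi:R\to T$ be a surjective homomorphism, and let $B=\mathsf{K}_T(C,\chi)$ be the kernel--wreath skew brace, with $(B,+)=A^\Omega$ and $(B,\circ)\cong G=\ker\varepsilon\le W=R^\Omega\rtimes T$. Let $Q$ be a finite abelian group and let $\theta:R\to Q$ be a surjective homomorphism. Then $$\Theta:G\to Q,\qquad \Theta\big((r_x)_{x\in\Omega},u\big)=\prod_{x\in\Omega}\theta(r_x),$$ is a surjective group homomorphism.
   Context: A skew brace is a triple $(B,+,\circ)$ such that $(B,+)$ and $(B,\circ)$ are groups (neither assumed abelian) on the same set and $a\circ(b+c)=a\circ b-a+a\circ c$ for all $a,b,c\in B$. Its lambda map is the homomorphism $\lambda^B:(B,\circ)\to\mathrm{Aut}(B,+)$, $\lambda^B_a(b)=-a+a\circ b$. The kernel--wreath skew brace $\mathsf{K}_T(C,\chi)$: let $\pi:R\to A$ be the identity map on the underlying set of $C$. The group $T$ acts on $R^\Omega$ by ${}^u(r_x)_{x\in\Omega}=(r_{u^{-1}x})_{x\in\Omega}$; let $W=R^\Omega\rtimes T$, with $(r,u)(s,v)=(r\,{}^us,uv)$. The group $W$ acts on $A^\Omega$ by $(r,u)\cdot(a_x)_x=\big(\pi(r_x)+\lambda^C_{r_x}(a_{u^{-1}x})\big)_x$. Let $\varepsilon:W\to T$ be the homomorphism $\varepsilon((r_x)_x,u)=\big(\prod_{x\in\Omega}\chi(r_x)\big)u$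 and $G=\ker\varepsilon$. The group $G$ acts regularly on $A^\Omega$, and $\Pi:G\to A^\Omega$, $\Pi((r_x)_x,u)=(\pi(r_x))_x$, is a bijection. Then $\mathsf{K}_T(C,\chi)$ is the skew brace with underlying set $A^\Omega$, whose addition is that of the direct product $A^\Omega$ and whose multiplication is the group structure of $G$ transported along $\Pi$. *)

(* Defs.v *)
From HB Require Import structures.
From mathcomp Require Import all_boot all_fingroup.

Set Implicit Arguments.
Unset Strict Implicit.
Unset Printing Implicit Defensive.

Import GroupScope.

HB.mixin Record isSkewBrace B := {
  sbadd : B -> B -> B;
  sb0 : B;
  sbopp : B -> B;
  sbmul : B -> B -> B;
  sb1 : B;
  sbinv : B -> B;
  sbaddA : associative sbadd;
  sbadd0l : left_id sb0 sbadd;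
  sbadd0r : right_id sb0 sbadd;
  sbaddNl : left_inverse sb0 sbopp sbadd;
  sbaddNr : right_inverse sb0 sbopp sbadd;
  sbmulA : associative sbmul;
  sbmul1l : left_id sb1 sbmul;
  sbmul1r : right_id sb1 sbmul;
  sbmulVl : left_inverse sb1 sbinv sbmul;
  sbmulVr : right_inverse sb1 sbinv sbmul;
  sbmulD : forall a b c,
    sbmul a (sbadd b c) = sbadd (sbadd (sbmul a b) (sbopp a)) (sbmul a c)
}.

#[short(type="skewBraceType")]
HB.structure Definition SkewBrace := {B of isSkewBrace B & Choice B}.

#[short(type="finSkewBraceType")]
HB.structure Definition FinSkewBrace := {B of isSkewBrace B & Finite B}.

(* MathComp attaches at most one group law to a type, so (B, +) and (B, o) are
   two aliases of the carrier.  Both laws are written multiplicatively. *)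
Definition addgrp (B : skewBraceType) : Type := B.
Definition mulgrp (B : skewBraceType) : Type := B.

HB.instance Definition _ (B : skewBraceType) := Choice.copy (addgrp B) B.
HB.instance Definition _ (B : skewBraceType) := isGroup.Build (addgrp B)
  (@sbaddA B) (@sbadd0l B) (@sbadd0r B) (@sbaddNl B) (@sbaddNr B).
HB.instance Definition _ (B : finSkewBraceType) := Finite.copy (addgrp B) B.

HB.instance Definition _ (B : skewBraceType) := Choice.copy (mulgrp B) B.
HB.instance Definition _ (B : skewBraceType) := isGroup.Build (mulgrp B)
  (@sbmulA B) (@sbmul1l B) (@sbmul1r B) (@sbmulVl B) (@sbmulVr B).
HB.instance Definition _ (B : finSkewBraceType) := Finite.copy (mulgrp B) B.

(* The direct power H^T; this form carries MathComp's pointwise group law. *)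
Notation dpower T H := {dffun forall _ : T, H}.

Section Wreath.
Context (R T : finGroupType).

Definition shift (u : T) (r : dpower T R) : dpower T R :=
  [ffun x => r (u^-1 * x)].

(* MathComp's [sdprod_by] uses right actions, hence a different product. *)
Definition wreath : Type := (dpower T R * T)%type.

HB.instance Definition _ := Finite.copy wreath (dpower T R * T)%type.

Definition wreath_mul (w z : wreath) : wreath :=
  (w.1 * shift w.2 z.1, w.2 * z.2).
Definition wreath_one : wreath := (1, 1).
Definition wreath_inv (w : wreath) : wreath := (shift w.2^-1 w.1^-1, w.2^-1).

Fact wreath_mulA : associative wreath_mul.
Proof.
move=> [r u] [s v] [t w]; rewrite /wreath_mul /= mulgA; congr pair.
by apply/ffunP => x; rewrite !ffunE mulgA invMg mulgA.
Qed.

Fact wreath_mul1 : left_id wreath_one wreath_mul.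
Proof.
move=> [r u]; rewrite /wreath_mul /= !mul1g; congr pair.
by apply/ffunP => x; rewrite ffunE invg1 mul1g.
Qed.

Fact wreath_mulV : left_inverse wreath_one wreath_inv wreath_mul.
Proof.
move=> [r u]; rewrite /wreath_mul /= mulVg; congr pair.
by apply/ffunP => x; rewrite !ffunE mulVg.
Qed.

HB.instance Definition _ :=
  Finite_isGroup.Build wreath wreath_mulA wreath_mul1 wreath_mulV.

End Wreath.

Lemma abelian_mulC (T : finGroupType) : abelian [set: T] -> commutative (@mul T).
Proof. by move=> /centsP abT x y; apply: abT. Qed.

Lemma prodM_abelian (T Q : finGroupType) (f g : T -> Q) :
  abelian [set: Q] ->
  \prod_(x : T) (f x * g x) = \prod_(x : T) f x * \prod_(x : T) g x.
Proof.
move=> /abelian_mulC mulC.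
elim/big_rec3: _ => [|x a b c _ ->]; first by rewrite mulg1.
by rewrite -!mulgA; congr (_ * _); rewrite !mulgA (mulC (g x)).
Qed.

Lemma prod_shift_abelian (T Q : finGroupType) (f : T -> Q) (u : T) :
  abelian [set: Q] -> \prod_(x : T) f (u^-1 * x) = \prod_(x : T) f x.
Proof.
move=> /abelian_mulC mulC.
pose Q_com := SemiGroup.isComLaw.Build Q (@mul Q) (@mulgA Q) mulC.
pose op : SemiGroup.com_law Q := HB.pack (@mul Q) Q_com.
by symmetry; apply: (@reindex_inj _ op _ _ _ xpredT f (mulgI u^-1)).
Qed.

Section KernelWreath.
Context (C : finSkewBraceType) (T : finGroupType) (abT : abelian [set: T]).
Context (chi : {morphism [set: mulgrp C] >-> T}).

Let A : finGroupType := addgrp C.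
Let R : finGroupType := mulgrp C.
Let W : finGroupType := wreath R T.

Definition kw_eps (w : W) : T := (\prod_(x : T) chi (w.1 x)) * w.2.

Fact kw_epsM : {in [set: W] &, {morph kw_eps : w z / w * z}}.
Proof.
move=> [r u] [s v] _ _; rewrite /kw_eps /=.
under eq_bigr => x _ do rewrite !ffunE morphM ?inE //.
rewrite prodM_abelian // (prod_shift_abelian (fun x => chi (s x))) //.
rewrite -!mulgA; congr (_ * _).
by rewrite !mulgA (abelian_mulC abT u).
Qed.

Canonical kw_eps_morphism := Morphism kw_epsM.

Definition kw_ker : {group W} := 'ker kw_eps.

Definition kw_Pi (w : W) : dpower T A := w.1.

Definition kw_Pi_inv (a : dpower T A) : W :=
  (a : dpower T R, (\prod_(x : T) chi (a x))^-1).

Lemma kw_Pi_inv_in a : kw_Pi_inv a \in kw_ker.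
Proof. by apply/kerP; rewrite ?inE // /= /kw_eps /kw_Pi_inv /= mulgV. Qed.

Lemma kw_Pi_invK : cancel kw_Pi_inv kw_Pi.
Proof. by []. Qed.

Lemma kw_PiK : {in kw_ker, cancel kw_Pi kw_Pi_inv}.
Proof.
move=> [r u] /kerP -/(_ (in_setT _)) /= /eqP; rewrite /kw_eps /= => eps1.
by rewrite /kw_Pi_inv /kw_Pi /=; congr pair; apply/eqP; rewrite eq_invg_mul.
Qed.

(* Underlying set of K_T(C, chi).  The multiplication depends on chi and is a
   group law because T is abelian, so both are recorded in the type. *)
Definition kernel_wreath of abelian [set: T] &
  {morphism [set: mulgrp C] >-> T} : Type := dpower T A.
Local Notation K := (kernel_wreath abT chi).

HB.instance Definition _ := Finite.copy K (dpower T A).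

Definition kw_mul (a b : K) : K := kw_Pi (kw_Pi_inv a * kw_Pi_inv b).
Definition kw_one : K := kw_Pi 1.
Definition kw_inv (a : K) : K := kw_Pi (kw_Pi_inv a)^-1.

Fact kw_mulA : associative kw_mul.
Proof.
by move=> a b c; rewrite /kw_mul !kw_PiK ?groupM ?kw_Pi_inv_in // mulgA.
Qed.
Fact kw_mul1l : left_id kw_one kw_mul.
Proof. by move=> a; rewrite /kw_mul kw_PiK // mul1g kw_Pi_invK. Qed.
Fact kw_mul1r : right_id kw_one kw_mul.
Proof. by move=> a; rewrite /kw_mul [kw_Pi_inv kw_one]kw_PiK // mulg1. Qed.
Fact kw_mulVl : left_inverse kw_one kw_inv kw_mul.
Proof. by move=> a; rewrite /kw_mul kw_PiK ?groupV ?kw_Pi_inv_in // mulVg. Qed.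
Fact kw_mulVr : right_inverse kw_one kw_inv kw_mul.
Proof.
by move=> a; rewrite /kw_mul [kw_Pi_inv (kw_inv a)]kw_PiK
  ?groupV ?kw_Pi_inv_in // mulgV.
Qed.

Fact kw_mulD (a b c : K) :
  kw_mul a ((b : dpower T A) * c) =
    ((kw_mul a b : dpower T A) * (a : dpower T A)^-1) * kw_mul a c.
Proof. by apply/ffunP => x; rewrite !ffunE; apply: sbmulD. Qed.

HB.instance Definition _ := isSkewBrace.Build K
  (@mulgA (dpower T A)) (@mul1g (dpower T A)) (@mulg1 (dpower T A))
  (@mulVg (dpower T A)) (@mulgV (dpower T A))
  kw_mulA kw_mul1l kw_mul1r kw_mulVl kw_mulVr kw_mulD.

Lemma kw_PiM :
  {in kw_ker &, {morph (kw_Pi : W -> mulgrp K) : w z / w * z}}.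
Proof.
move=> w z Gw Gz; rewrite [RHS]/(kw_mul (kw_Pi w) (kw_Pi z)).
by rewrite /kw_mul !kw_PiK.
Qed.

End KernelWreath.

Definition kw_Theta (R T Q : finGroupType) (theta : {morphism [set: R] >-> Q})
  (w : wreath R T) : Q := \prod_(x : T) theta (w.1 x).

(* Main.v *)
Require Import Defs.
From mathcomp Require Import all_boot all_fingroup.

Import GroupScope.

(** Multiplicativity holds on all of W, because Q is abelian.  For surjectivity,
    write q = theta r and take the function equal to r at 1 and trivial
    elsewhere: the T-component chi(r)^-1 puts it in ker epsilon, and its image
    under Theta is theta r. *)

Lemma kw_ThetaM (R T Q : finGroupType) (theta : {morphism [set: R] >-> Q}) :
  abelian [set: Q] -> {morph kw_Theta (T := T) theta : w z / w * z}.
Proof.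
move=> abQ [r u] [s v]; rewrite /kw_Theta /=.
under eq_bigr => x _ do rewrite !ffunE morphM ?inE //.
(* The action of [u] on [s] merely reindexes the second product by a left translation of [T]. *)
by rewrite prodM_abelian // (prod_shift_abelian (fun x => theta (s x))).
Qed.

(** Only the factor at [t] can differ from 1. Keeping [u] arbitrary lets the lemma apply to
    whichever [T]-component membership in the kernel forces. *)
Lemma kw_Theta_single (R T Q : finGroupType) (theta : {morphism [set: R] >-> Q})
  (r : R) (t u : T) :
  kw_Theta (T := T) theta ([ffun x => if x == t then r else 1], u) = theta r.
Proof.
rewrite /kw_Theta /=.
under eq_bigr => x _ do rewrite ffunE (fun_if theta) morph1.
by rewrite -big_mkcond big_pred1_eq.
Qed.

Theorem proposition3p4
  (C : finSkewBraceType)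
  (T : finGroupType) (abT : abelian [set: T]) (ntT : [set: T] != 1)
  (chi : {morphism [set: mulgrp C] >-> T})
  (chi_surj : chi @* [set: mulgrp C] = [set: T])
  (B : finSkewBraceType) (defB : B = kernel_wreath abT chi)
  (Q : finGroupType) (abQ : abelian [set: Q])
  (theta : {morphism [set: mulgrp C] >-> Q})
  (theta_surj : theta @* [set: mulgrp C] = [set: Q]) :
  let G := kw_ker abT chi in
  let Theta := kw_Theta (T := T) theta in
  {in G &, {morph Theta : w z / w * z}} /\ Theta @: G = [set: Q].
Proof.
move=> G Theta; split; first by move=> w z _ _; apply: kw_ThetaM.
apply/setP => q; rewrite inE.
have: q \in theta @* [set: mulgrp C] by rewrite theta_surj inE.
case/morphimP => r _ _ ->.
pose a : dpower T (mulgrp C) := [ffun x => if x == 1 then r else 1].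
(* [kw_Pi_inv] supplies the only [T]-component that puts [a] in [G], left as an unevaluated
   product. *)
apply/imsetP; exists (kw_Pi_inv chi a); first exact: kw_Pi_inv_in.
by rewrite [RHS]kw_Theta_single.
Qed.
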